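(* Let $F$ be a forest with $r$ vertices contained in the complete graph $K_s$ on $s$ vertices. Let $G=K_s-F$. Then: (1) $[Z^o_G]\in\mathbf{Z}[q]$. (2) If $s>r$, then $[X_G]\in\mathbf{Z}[q]$.
   Context: A forest is a graph with no cycles. $K_s-F$ denotes the graph obtained from $K_s$ by removing the edges of $F$ but keeping all $s$ vertices. For a scheme $X$ of finite type over $\mathbf{Z}$, $[X]$ is the function $q\mapsto\#X(\mathbf{F}_q)$ on prime powers $q$; $[X]\in\mathbf{Z}[q]$ means that this function is given by a polynomial with integer coefficients. For a finite simple graph $G$ with vertices $v_1,\dots,v_n$, $Z^o_G$ is the scheme over $\mathbf{Z}$ of all nondegenerate (invertible) symmetric $n\times n$ matrices $M$ such that $M_{ij}=0$ whenever $i\ne j$ and there is no edge from $v_i$ to $v_j$. For a finite graph $G$ with edge set $E$ and a variable $x_e$ for each edge, $Q_G=\sum_T\prod_{e\in T}x_e$, the sum over all spanning trees $T$ of $G$, and $X_G=\mathbf{A}^E_{\mathbf{Z}}-V(Q_G)$, so $\#X_G(\mathbf{F}_q)=\#\{x\in\mathbf{F}_q^E: Q_G(x)\neq0\}$. *)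

(* Defs.v *)
From HB Require Import structures.
From mathcomp Require Import all_boot all_order all_algebra.

Set Implicit Arguments.
Unset Strict Implicit.
Unset Printing Implicit Defensive.

Import GRing.Theory.
Local Open Scope ring_scope.

(* A finite simple graph with vertex set T is a symmetric irreflexive
   [e : rel T]. *)
Definition simple_graph (T : finType) (e : rel T) : Prop :=
  symmetric e /\ irreflexive e.

(* A cycle visits at least three vertices, all distinct; bounding its length
   by #|T| only serves to make the predicate boolean (see [forestP]). *)
Definition forest (T : finType) (e : rel T) : bool :=
  [forall k : 'I_#|T|.+1, forall c : k.-tuple T,
     (2 < k)%N ==> ~~ ucycleb e c].

Lemma forestP (T : finType) (e : rel T) :
  reflect (forall c : seq T, (2 < size c)%N -> ~ ucycle e c) (forest e).
Proof.
apply: (iffP idP) => [acy c c2 cyc | acy].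
  have ck : (size c < #|T|.+1)%N.
    by case/andP: cyc => _ /card_uniqP <-; rewrite ltnS max_card.
  have /forallP/(_ (in_tuple c))/implyP/(_ c2) := forallP acy (Ordinal ck).
  by rewrite /= (cyc : ucycleb e c).
apply/forallP => k; apply/forallP => c; apply/implyP => k2.
by apply/negP => cyc; apply: (acy c); rewrite ?size_tuple.
Qed.

Definition connected (T : finType) (e : rel T) : bool :=
  [forall x, forall y, connect e x y].

(* K_s - F *)
Definition complete_minus (s : nat) (f : rel 'I_s) : rel 'I_s :=
  [rel x y | (x != y) && ~~ f x y].

(* [X] \in Z[q], for X given by its number of points over each finite field. *)
Definition polynomial_count (N : finFieldType -> nat) : Prop :=
  exists p : {poly int}, forall K : finFieldType, (N K)%:Z = p.[#|K|%:Z].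

(* Z^o_G(K) *)
Definition Zo (n : nat) (e : rel 'I_n) (K : finFieldType) : {set 'M[K]_n} :=
  [set M : 'M[K]_n | [&& M^T == M, M \in unitmx &
     [forall i, forall j, (i != j) && ~~ e i j ==> (M i j == 0)]]].

Definition edge_set (T : finType) (e : rel T) : {set {set T}} :=
  [set a : {set T} | [exists x, exists y, e x y && (a == [set x; y])]].

Definition edge (T : finType) (e : rel T) : finType :=
  {a : {set T} | a \in edge_set e}.

(* The spanning subgraph of e with edge set A. *)
Definition span_rel (T : finType) (e : rel T) (A : {set edge e}) : rel T :=
  [rel x y | (x != y) && [exists a in A, val a == [set x; y]]].

Definition spanning_tree (T : finType) (e : rel T) (A : {set edge e}) : bool :=
  connected (span_rel A) && forest (span_rel A).

(* The value of Q_G at a point x of R^E. *)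
Definition Q (T : finType) (e : rel T) (R : comNzRingType)
    (x : {ffun edge e -> R}) : R :=
  \sum_(A : {set edge e} | spanning_tree A) \prod_(a in A) x a.

(* X_G(K) *)
Definition X (T : finType) (e : rel T) (K : finFieldType) :
    {set {ffun edge e -> K}} :=
  [set x : {ffun edge e -> K} | Q x != 0].

(* Main.v *)
(* Let N(S, z) be the number of invertible symmetric matrices on a vertex set S
   of size m that vanish on the pattern z. If v, w are in S and no entry in the
   row of v is prescribed, let z' be z with the entry (v, w) added. If the
   column of w has a nonzero entry in some row j <> v, then the basis changes
   e_v <- e_v + c e_j make the entry (v, w) uniformly distributed; otherwise the
   matrix is determined by its rows at v and w and an invertible matrix on
   S - v - w. Hence
     N(S, z) = q N(S, z') + (q - 1) q^(m - 1) N(S - v - w, z).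
   Adding the edges of a star one at a time, this computes N(S, no zeros) by
   induction on m. Used in the other direction at a leaf v of a forest, it
   expresses q N(S, F) through forests with fewer edges, and the division by q
   is possible in Z[q] because N(S, F) is an integer at every prime q.

   If some vertex v is outside V, it is joined in G to all other vertices, so
   the reduced Laplacian at v is an arbitrary symmetric matrix vanishing on F,
   and the matrix-tree theorem identifies X_G with Z^o of G - v. *)
Require Import Defs.
From HB Require Import structures.
From mathcomp Require Import all_boot all_order all_algebra.
From mathcomp Require Import fingroup perm ring.

Set Implicit Arguments.
Unset Strict Implicit.
Unset Printing Implicit Defensive.

Import GRing.Theory Num.Theory.
Local Open Scope ring_scope.

(** * Counting symmetric matrices with prescribed zeros *)

Lemma card_can_in (T1 T2 : finType) (A : {set T1}) (B : {set T2})
    (g : T1 -> T2) (h : T2 -> T1) :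
    {in A, forall x, g x \in B /\ h (g x) = x} ->
    {in B, forall y, h y \in A /\ g (h y) = y} -> #|A| = #|B|.
Proof.
move=> gP hP; rewrite -(card_in_imset (f := g)); last first.
  move=> x y Ax Ay eq_g.
  by rewrite -(gP x Ax).2 -(gP y Ay).2 eq_g.
apply: eq_card => y; apply/imsetP/idP => [[x /gP[Bgx _] ->] //|By].
by exists (h y); have [] := hP y By.
Qed.

Lemma unitmxP (K : fieldType) (n : nat) (A : 'M[K]_n) :
  reflect (forall u : 'rV_n, u *m A = 0 -> u = 0) (A \in unitmx).
Proof.
apply: (iffP idP) => [uA u uA0|A0]; last by rewrite -row_free_unit inj_row_free.
by rewrite -(mulmxK uA u) uA0 mul0mx.
Qed.

(* Matrices of forms on K^S with zeros prescribed by z, extended by the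
   identity outside S so that deleting vertices does not change the matrix
   size. *)
Definition symunit (n : nat) (S : {set 'I_n}) (z : rel 'I_n)
    (K : finFieldType) : {set 'M[K]_n} :=
  [set M : 'M[K]_n | [&& M^T == M, M \in unitmx,
     [forall x in S, forall y in S, z x y ==> (M x y == 0)] &
     [forall x, forall y, (x \notin S) ==> (M x y == (x == y)%:R)]]].

Lemma symunitP (n : nat) (S : {set 'I_n}) (z : rel 'I_n) (K : finFieldType)
    (M : 'M[K]_n) :
  reflect [/\ forall x y, M x y = M y x, M \in unitmx,
    forall x y, x \in S -> y \in S -> z x y -> M x y = 0 &
    forall x y, x \notin S -> M x y = (x == y)%:R] (M \in symunit S z K).
Proof.
rewrite inE; apply: (iffP and4P) => [[/eqP symM uM zM idM]|[symM uM zM idM]].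
  split=> // [x y|x y Sx Sy zxy|x y Sx].
  - by rewrite -{1}symM mxE.
  - move/forall_inP: zM => /(_ x Sx)/forall_inP/(_ y Sy)/implyP.
    by move=> /(_ zxy)/eqP.
  - by move/forallP: idM => /(_ x)/forallP/(_ y)/implyP/(_ Sx)/eqP.
split=> //.
- by apply/eqP/matrixP => x y; rewrite mxE.
- apply/forall_inP => x Sx; apply/forall_inP => y Sy; apply/implyP => zxy.
  by rewrite zM.
- apply/forallP => x; apply/forallP => y; apply/implyP => Sx.
  by rewrite idM.
Qed.
(** In a symmetric matrix a zero at [(x, y)] is a zero at [(y, x)], so only the symmetric closure of
    the pattern on [S] counts. Patterns such as [z'] and [star] may thus list each edge in one
    direction. *)
Lemma eq_symunit (n : nat) (S : {set 'I_n}) (z1 z2 : rel 'I_n)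
    (K : finFieldType) :
    {in S &, forall x y, z1 x y || z1 y x = z2 x y || z2 y x} ->
  symunit S z1 K = symunit S z2 K.
Proof.
move=> eqz; apply/setP => M; apply/idP/idP => /symunitP[symM uM zM idM];
  apply/symunitP; split=> // x y Sx Sy zxy.
  have /orP[] : z1 x y || z1 y x by rewrite eqz // zxy.
    exact: zM.
  by move=> zyx; rewrite symM zM.
have /orP[] : z2 x y || z2 y x by rewrite -eqz // zxy.
  exact: zM.
by move=> zyx; rewrite symM zM.
Qed.

Lemma card_symunit0 (n : nat) (z : rel 'I_n) (K : finFieldType) :
  #|symunit set0 z K| = 1%N.
Proof.
rewrite (_ : symunit _ _ _ = [set 1%:M]) ?cards1 //.
apply/setP => M; rewrite in_set1; apply/symunitP/eqP => [[_ _ _ idM]|->].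
  by apply/matrixP => x y; rewrite mxE idM ?inE.
split=> [x y||x y|x y _]; rewrite ?unitmx1 ?inE ?mxE //.
by rewrite eq_sym.
Qed.

(* The matrix of M after the basis change e_v <- e_v + c e_j. *)
Definition shear (n : nat) (K : finFieldType) (v : 'I_n) (c : K) (j : 'I_n)
    (M : 'M[K]_n) : 'M[K]_n :=
  (1%:M + c *: delta_mx v j) *m M *m (1%:M + c *: delta_mx j v).

Lemma shearE (n : nat) (K : finFieldType) (v : 'I_n) (c : K) (j : 'I_n)
    (M : 'M[K]_n) (x y : 'I_n) :
  shear v c j M x y = M x y + (x == v)%:R * c * M j y + (y == v)%:R * c * M x j
    + (x == v)%:R * (y == v)%:R * c ^+ 2 * M j j.
Proof.
have mull (A : 'M[K]_n) a b :
    ((1%:M + c *: delta_mx v j) *m A) a b = A a b + (a == v)%:R * c * A j b.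
  rewrite mulmxDl mul1mx mxE; congr (_ + _).
  rewrite mxE (bigD1 j) //= big1 ?addr0 => [|i ne_ij]; rewrite !mxE ?eqxx ?andbT.
    by rewrite [c * _]mulrC.
  by rewrite (negPf ne_ij) andbF mulr0 mul0r.
have mulr (A : 'M[K]_n) a b :
    (A *m (1%:M + c *: delta_mx j v)) a b = A a b + (b == v)%:R * c * A a j.
  rewrite mulmxDr mulmx1 mxE; congr (_ + _).
  rewrite mxE (bigD1 j) //= big1 ?addr0 => [|i ne_ij]; rewrite !mxE ?eqxx /=.
    by rewrite mulrC [c * _]mulrC.
  by rewrite (negPf ne_ij) mulr0 mulr0.
by rewrite /shear mulr !mull; ring.
Qed.

Lemma unitmx_shear (n : nat) (K : finFieldType) (v : 'I_n) (c : K) (j : 'I_n)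
    (M : 'M[K]_n) :
  j != v -> (shear v c j M \in unitmx) = (M \in unitmx).
Proof.
move=> ne_jv; rewrite !unitmx_mul.
have uE (a b : 'I_n) : a != b -> (1%:M + c *: delta_mx a b : 'M[K]_n) \in unitmx.
  move=> ne_ab.
  suff /mulmx1_unit[] : (1%:M + c *: delta_mx a b : 'M[K]_n)
    *m (1%:M - c *: delta_mx a b) = 1%:M by [].
  rewrite mulmxDl mul1mx mulmxBr mulmx1 -scalemxAl -scalemxAr mul_delta_mx_cond.
  by rewrite (eq_sym b) (negPf ne_ab) mulr0n !scaler0 subr0 subrK.
by rewrite !uE ?andbT // eq_sym.
Qed.

Lemma shearK (n : nat) (K : finFieldType) (v : 'I_n) (c : K) (j : 'I_n)
    (M : 'M[K]_n) :
  j != v -> shear v (- c) j (shear v c j M) = M.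
Proof.
move=> ne_jv; apply/matrixP => x y.
by rewrite !shearE (negPf ne_jv) /=; ring.
Qed.

(** A shear alters only row and column [v], where nothing is prescribed; having [j] in [S] keeps the
    identity rows outside [S] intact. *)
Lemma symunit_shear (n : nat) (S : {set 'I_n}) (z : rel 'I_n)
    (K : finFieldType) (v : 'I_n) (c : K) (j : 'I_n) (M : 'M[K]_n) :
    v \in S -> j \in S -> j != v ->
    {in S, forall x, ~~ z v x && ~~ z x v} ->
  M \in symunit S z K -> shear v c j M \in symunit S z K.
Proof.
move=> Sv Sj ne_jv zv /symunitP[symM uM zM idM]; apply/symunitP; split.
- move=> x y; rewrite !shearE (symM y x) (symM j x) (symM j y).
  by ring.
- by rewrite unitmx_shear.
- move=> x y Sx Sy zxy; rewrite shearE zM // add0r.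
  case: eqP zxy => [->|_]; first by rewrite (negPf (andP (zv y Sy)).1).
  case: eqP => [->|_]; first by rewrite (negPf (andP (zv x Sx)).2).
  by rewrite !mul0r !addr0.
- move=> x y Sx; rewrite shearE !(idM x) //.
  have [eqx|ne_xv] := eqVneq x v; first by rewrite eqx Sv in Sx.
  have [eqx|ne_xj] := eqVneq x j; first by rewrite eqx Sj in Sx.
  by rewrite mulr0 !mul0r !addr0.
Qed.

(** * The recursion at a vertex with an unrestricted row *)

Section Leaf.
Variables (n : nat) (S : {set 'I_n}) (z : rel 'I_n) (K : finFieldType).
Variables v w : 'I_n.
Hypotheses (Sv : v \in S) (Sw : w \in S) (ne_vw : v != w).
Hypothesis zv : {in S, forall x, ~~ z v x && ~~ z x v}.

Let z' : rel 'I_n := [rel x y | z x y || (x == v) && (y == w)].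
Let column_nz (M : 'M[K]_n) := [exists j, (j != v) && (M j w != 0)].
(** Row [v] is excluded so that shears in [v] do not change the choice; the default [v] is never
    taken when [column_nz] holds. *)
Let pivot (M : 'M[K]_n) := odflt v [pick j | (j != v) && (M j w != 0)].

Lemma pivotP (M : 'M[K]_n) : column_nz M -> pivot M != v /\ M (pivot M) w != 0.
Proof.
rewrite /pivot => /existsP nzM; case: pickP => [j /andP[] //|noj].
by case: nzM => j; rewrite noj.
Qed.

Lemma pivot_shear (c : K) (j : 'I_n) (M : 'M[K]_n) :
  pivot (shear v c j M) = pivot M.
Proof.
rewrite /pivot; congr odflt; apply: eq_pick => x.
rewrite shearE; case: eqP => //= _.
by rewrite (eq_sym w) (negPf ne_vw) !mul0r !addr0.
Qed.

Lemma column_nz_shear (c : K) (j : 'I_n) (M : 'M[K]_n) :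
  column_nz (shear v c j M) = column_nz M.
Proof.
apply: eq_existsb => x; rewrite shearE; case: eqP => //= _.
by rewrite (eq_sym w) (negPf ne_vw) !mul0r !addr0.
Qed.

Lemma symunit_pivot (M : 'M[K]_n) :
  M \in symunit S z K -> column_nz M -> pivot M \in S.
Proof.
move=> /symunitP[_ _ _ idM] /pivotP[_]; apply: contraR => nSp.
by rewrite idM // (eq_sym (pivot M)) (negPf (memPn nSp _ Sw)) eqxx.
Qed.

Lemma symunit_add_edge (M : 'M[K]_n) :
  (M \in symunit S z' K) = (M \in symunit S z K) && (M v w == 0).
Proof.
apply/symunitP/andP => [[symM uM zM idM]|[/symunitP[symM uM zM idM] /eqP Mvw]].
  split; last by apply/eqP/zM; rewrite // /z' /= !eqxx orbT.
  by apply/symunitP; split=> // x y Sx Sy zxy; rewrite zM // /z' /= zxy.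
split=> // x y Sx Sy /= /orP[|/andP[/eqP-> /eqP->] //].
exact: zM.
Qed.

(** Otherwise the whole column [w] would vanish, against invertibility. *)
Lemma symunit_column_nz (M : 'M[K]_n) : M \in symunit S z' K -> column_nz M.
Proof.
rewrite symunit_add_edge => /andP[/symunitP[_ uM _ _] /eqP Mvw].
apply: contraT; rewrite negb_exists => /forallP noj; exfalso.
have : delta_mx 0 w *m M^T = 0 :> 'rV_n.
  rewrite -rowE; apply/rowP => x; rewrite !mxE.
  have [->//|ne_xv] := eqVneq x v.
  by move: (noj x); rewrite ne_xv negbK => /eqP.
move/unitmxP; rewrite unitmx_tr => /(_ uM)/rowP/(_ w).
by rewrite !mxE !eqxx => /eqP; rewrite oner_eq0.
Qed.

(** Exactly one shear along the pivot clears the entry [(v, w)]. Since the pivot can be found again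
    in the cleared matrix, [M] corresponds to the cleared matrix together with the shear
    coefficient. *)
Lemma card_symunit_column_nz :
  #|[set M in symunit S z K | column_nz M]| = (#|K| * #|symunit S z' K|)%N.
Proof.
rewrite mulnC -cardsT -cardsX.
pose g (M : 'M[K]_n) :=
  let c := M v w / M (pivot M) w in (shear v (- c) (pivot M) M, c).
pose h (p : 'M[K]_n * K) := shear v p.2 (pivot p.1) p.1.
apply: (card_can_in (g := g) (h := h)) => [M|[M c]].
  case/setIdP=> zM nzM; have [ne_pv nzp] := pivotP nzM.
  have Sp := symunit_pivot zM nzM.
  split.
    rewrite in_setX in_setT andbT symunit_add_edge symunit_shear //= shearE eqxx.
    rewrite (eq_sym w) (negPf ne_vw) mulr0 !mul0r !addr0 mul1r mulNr.
    by rewrite divfK // subrr.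
  by rewrite /h /g /= pivot_shear -{1}[_ / _]opprK shearK.
rewrite in_setX in_setT andbT /= => zM; have nzM := symunit_column_nz zM.
move: zM; rewrite symunit_add_edge => /andP[zM /eqP Mvw].
have [ne_pv nzp] := pivotP nzM; have Sp := symunit_pivot zM nzM.
split.
  by apply/setIdP; rewrite /h /= symunit_shear //= column_nz_shear.
rewrite /g /h /= pivot_shear !shearE eqxx (negPf ne_pv) (eq_sym w).
rewrite (negPf ne_vw) /= Mvw !mulr0 !mul0r !addr0 add0r mul1r.
by rewrite mulfK // shearK.
Qed.

(** The general shape of a symmetric matrix whose column [w] vanishes off row [v]. *)
Let border (c : K) (b : 'I_n -> K) (M : 'M[K]_n) : 'M[K]_n :=
  \matrix_(x, y) if x == v then (if y == w then c else b y)
                 else if y == v then (if x == w then c else b x)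
                 else if (x == w) || (y == w) then 0 else M x y.

(** A row vector [u] in the kernel is found column by column: column [w] gives [u 0 v * c = 0], the
    columns other than [v] and [w] then say that [M] kills the rest of [u], and column [v]
    determines [u 0 w] because [c] is invertible. *)
Lemma unitmx_border (c : K) (b : 'I_n -> K) (M : 'M[K]_n) :
    (forall x y, (x == v) || (x == w) -> M x y = (x == y)%:R) ->
    (forall x y, (x == v) || (x == w) -> M y x = (y == x)%:R) ->
  (border c b M \in unitmx) = (c != 0) && (M \in unitmx).
Proof.
move=> idr idc; set B := border c b M.
have mulBw u : (u *m B) 0 w = u 0 v * c.
  rewrite mxE (bigD1 v) //= mxE !eqxx big1 ?addr0 // => x ne_xv.
  by rewrite mxE (negPf ne_xv) (eq_sym w) (negPf ne_vw) eqxx orbT mulr0.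
have mulBv u : (u *m B) 0 v =
    u 0 v * b v + u 0 w * c + \sum_(x | (x != v) && (x != w)) u 0 x * b x.
  rewrite mxE (bigD1 v) //= (bigD1 w) 1?eq_sym //= addrA.
  rewrite !mxE !eqxx (negPf ne_vw) (eq_sym w) (negPf ne_vw); congr (_ + _).
  apply: eq_bigr => x /andP[ne_xv ne_xw].
  by rewrite mxE (negPf ne_xv) eqxx (negPf ne_xw).
have mulB u y : y != v -> y != w ->
    (u *m B) 0 y = u 0 v * b y + (u *m M) 0 y - u 0 v * M v y.
  move=> ne_yv ne_yw; rewrite !mxE (bigD1 v) //= [in RHS](bigD1 v) //=.
  rewrite mxE eqxx (negPf ne_yw) -addrA; congr (_ + _).
  rewrite addrAC subrr add0r; apply: eq_bigr => x ne_xv.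
  rewrite mxE (negPf ne_xv) (negPf ne_yv) (negPf ne_yw) orbF.
  by have [->|//] := eqVneq x w; rewrite idr ?eqxx ?orbT // eq_sym (negPf ne_yw).
have mulM u x : (x == v) || (x == w) -> (u *m M) 0 x = u 0 x.
  move=> vwx; rewrite mxE (bigD1 x) //= idc // eqxx mulr1 big1 ?addr0 //.
  by move=> i ne_ix; rewrite idc // (negPf ne_ix) mulr0.
apply/unitmxP/andP => [uB|[nzc /unitmxP uM] u uB0].
  have nzc : c != 0.
    apply/eqP => c0; have: delta_mx 0 w *m B = 0 :> 'rV_n.
      rewrite -rowE; apply/rowP => y; rewrite !mxE (eq_sym w) (negPf ne_vw) eqxx.
      by rewrite c0; case: eqP.
    move/uB/rowP/(_ w); rewrite !mxE !eqxx => /eqP.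
    by rewrite oner_eq0.
  split=> //; apply/unitmxP => u uM0.
  have u0 x : (x == v) || (x == w) -> u 0 x = 0.
    by move=> vwx; rewrite -mulM // uM0 mxE.
  pose s := \sum_(x | (x != v) && (x != w)) u 0 x * b x.
  (* The entry at [w] is chosen to cancel column [v] of the product, where it occurs with the factor
     [c]. *)
  pose u' : 'rV_n := \row_x if x == w then - s / c else u 0 x.
  have u'v : u' 0 v = 0 by rewrite mxE (negPf ne_vw) u0 ?eqxx.
  have u'0 : u' = 0.
    apply: uB; apply/rowP => y; rewrite [RHS]mxE.
    have [->|ne_yw] := eqVneq y w; first by rewrite mulBw u'v mul0r.
    have [->|ne_yv] := eqVneq y v.
      rewrite mulBv u'v mul0r add0r [u' 0 w]mxE eqxx divfK //.
      rewrite addrC; apply/eqP; rewrite subr_eq0; apply/eqP.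
      by apply: eq_bigr => x /andP[_ ne_xw]; rewrite mxE (negPf ne_xw).
    rewrite mulB // u'v !mul0r subr0 add0r; move/rowP/(_ y): (uM0).
    rewrite [in X in _ = X -> _]mxE => <-.
    rewrite !mxE; apply: eq_bigr => x _; rewrite mxE.
    have [->|//] := eqVneq x w.
    by rewrite idr ?eqxx ?orbT // eq_sym (negPf ne_yw) !mulr0.
  apply/rowP => x; rewrite [RHS]mxE.
  have [->|ne_xw] := eqVneq x w; first by rewrite u0 ?eqxx ?orbT.
  by move/rowP/(_ x): u'0; rewrite !mxE (negPf ne_xw).
have uv : u 0 v = 0.
  move/rowP/(_ w): (uB0); rewrite mulBw mxE => /eqP.
  by rewrite mulf_eq0 (negPf nzc) orbF => /eqP.
have nu x : x != w -> u 0 x = 0.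
  (* The entry at [w] is reset to 0, since [M] is the identity there and would return it
     unchanged. *)
  have : (\row_x if x == w then 0 else u 0 x) = 0 :> 'rV_n.
    apply: uM; apply/rowP => y; rewrite [RHS]mxE.
    have [->|ne_yw] := eqVneq y w; first by rewrite mulM ?eqxx ?orbT // mxE eqxx.
    have [->|ne_yv] := eqVneq y v.
      by rewrite mulM ?eqxx // mxE (negPf ne_vw).
    move/rowP/(_ y): (uB0); rewrite mulB // uv !mul0r subr0 add0r [in X in _ = X -> _]mxE.
    move=> <-; rewrite !mxE; apply: eq_bigr => i _; rewrite mxE.
    have [->|//] := eqVneq i w.
    by rewrite idr ?eqxx ?orbT // eq_sym (negPf ne_yw) !mulr0.
  by move/rowP/(_ x); rewrite !mxE => + /negPf ne_xw; rewrite ne_xw.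
apply/rowP => x; rewrite mxE; have [->|/nu//] := eqVneq x w.
move/rowP/(_ v): (uB0); rewrite mulBv uv mul0r add0r big1.
  rewrite addr0 mxE => /eqP; rewrite mulf_eq0 (negPf nzc) orbF.
  by move/eqP.
by move=> i /andP[_ /nu ->]; rewrite mul0r.
Qed.

(** These matrices are the [border c b M'] with [c] nonzero, [b] supported on [S :\ w] and [M']
    counted by the smaller [symunit]. *)
Lemma card_symunit_column_z :
  #|[set M in symunit S z K | ~~ column_nz M]| =
  (#|K|.-1 * #|K| ^ #|S|.-1 * #|symunit (S :\ v :\ w) z K|)%N.
Proof.
(* The support contains [v], for the diagonal entry, but not [w], whose place is taken by [c]; hence
   the exponent [#|S|.-1]. *)
pose b_supp := [set b : {ffun 'I_n -> K} | b \in pffun_on 0 (mem (S :\ w)) predT].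
have <- : #|b_supp| = (#|K| ^ #|S|.-1)%N.
  rewrite cardsE card_pffun_on; congr (_ ^ _)%N.
  by rewrite (cardsD1 w S) Sw.
have <- : #|[set~ 0 : K]| = #|K|.-1 by rewrite cardsC1.
rewrite -!cardsX.
pose g (M : 'M[K]_n) : (K * {ffun 'I_n -> K}) * 'M[K]_n :=
  ((M v w, [ffun x => if x == w then 0 else M v x]),
   \matrix_(x, y) if (x \in [set v; w]) || (y \in [set v; w])
                  then (x == y)%:R else M x y).
pose h (p : (K * {ffun 'I_n -> K}) * 'M[K]_n) := border p.1.1 p.1.2 p.2.
have neS (x y : 'I_n) : x \notin S -> y \in S -> (x == y) = false.
  by move=> nSx Sy; apply: contraNF nSx => /eqP->.
have Mx0 (M : 'M[K]_n) x : ~~ column_nz M -> x != v -> M x w = 0.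
  rewrite negb_exists => /forallP/(_ x) + ne_xv.
  by rewrite ne_xv negbK => /eqP.
have hg M : M \in symunit S z K -> ~~ column_nz M -> h (g M) = M.
  case/symunitP=> symM _ _ _ zM; apply/matrixP => x y; rewrite !mxE !ffunE /=.
  case: (eqVneq x v) => [->|ne_xv]; first by case: (eqVneq y w) => [->|].
  case: (eqVneq y v) => [->|ne_yv].
    by case: (eqVneq x w) => [->|]; rewrite symM.
  rewrite !in_set2 (negPf ne_xv) (negPf ne_yv) /=.
  case: (eqVneq x w) => [->|ne_xw] /=; first by rewrite symM Mx0.
  by case: (eqVneq y w) => [->|] //=; rewrite Mx0.
have gb M : M \in symunit S z K -> (g M).1.2 \in b_supp.
  case/symunitP=> symM _ _ idM; rewrite in_set; apply/pffun_onP; split=> //.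
  apply/subsetP => x; rewrite inE ffunE in_setD1.
  case: (eqVneq x w) => [_|ne_xw /=]; first by rewrite eqxx.
  apply: contraR => nSx; rewrite symM idM //.
  by rewrite neS ?eqxx.
have bord M : (forall x y, (x == v) || (x == w) -> (g M).2 x y = (x == y)%:R) /\
    (forall x y, (x == v) || (x == w) -> (g M).2 y x = (y == x)%:R).
  by split=> x y vwx; rewrite mxE !in_set2 vwx ?orbT.
have idp M : M \in symunit (S :\ v :\ w) z K ->
    (forall x y, (x == v) || (x == w) -> M x y = (x == y)%:R) /\
    (forall x y, (x == v) || (x == w) -> M y x = (y == x)%:R).
  case/symunitP=> symM _ _ idM.
  split=> x y vwx; [|rewrite symM eq_sym]; rewrite idM //.
    by case/orP: vwx => /eqP->; rewrite !in_setD1 eqxx ?andbF.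
  by case/orP: vwx => /eqP->; rewrite !in_setD1 eqxx ?andbF.
apply: (card_can_in (g := g) (h := h)) => [M /setIdP[zM nzM]|].
  split; last exact: hg.
  have [symM uM pM idM] := symunitP _ _ _ zM.
  have := uM; rewrite -{1}(hg M zM nzM) unitmx_border; try by case: (bord M).
  case/andP=> nzc uM''; rewrite !in_setX in_setC1 nzc gb //=.
  apply/symunitP; split=> // [x y|x y|x y].
  - by rewrite !mxE orbC eq_sym symM.
  - rewrite !in_setD1 mxE !in_set2 => /and3P[/negPf-> /negPf-> Sx].
    by case/and3P=> /negPf-> /negPf-> Sy; apply: pM.
  - rewrite !in_setD1 mxE !in_set2.
    case: eqP => //= _; case: eqP => //= _ nSx.
    by case: ifP => // _; rewrite idM.
case=> -[c b] M; rewrite !in_setX in_setC1 => /andP[/andP[nzc bp] Mp].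
have [idl idr] := idp M Mp.
move: bp; rewrite in_set => /pffun_onP[/subsetP bp _].
have b0 x : x \notin S :\ w -> b x = 0.
  by move=> nSx; apply/eqP; apply: contraR nSx => nzb; apply: bp; rewrite inE.
have [symM uM pM idM] := symunitP _ _ _ Mp.
have zhp : border c b M \in symunit S z K.
  apply/symunitP; split.
  - move=> x y; rewrite !mxE orbC symM.
    by case: (eqVneq x v) => ?; case: (eqVneq y v) => ?; subst.
  - by rewrite unitmx_border ?nzc.
  - move=> x y Sx Sy zxy; rewrite mxE.
    case: eqP zxy => [->|ne_xv]; first by rewrite (negPf (andP (zv Sy)).1).
    case: eqP => [->|ne_yv]; first by rewrite (negPf (andP (zv Sx)).2).
    move=> zxy; case: ifP => // /norP[ne_xw ne_yw].
    apply: pM => //; rewrite !in_setD1 ?ne_xw ?ne_yw ?Sx ?Sy ?andbT.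
      exact/eqP.
    exact/eqP.
  - move=> x y nSx; rewrite mxE (neS x v) // (neS x w) //= b0 ?in_setD1 ?(negPf nSx) ?andbF //.
    case: (eqVneq y v) => [->|ne_yv]; first by rewrite neS.
    case: (eqVneq y w) => [->|ne_yw]; first by rewrite neS.
    by rewrite idM // !in_setD1 (negPf nSx) !andbF.
split.
  apply/setIdP; split=> //; rewrite negb_exists; apply/forallP => x.
  rewrite mxE negb_and !negbK; case: (eqVneq x v) => //= _.
  by rewrite (eq_sym w) (negPf ne_vw) eqxx orbT.
congr (_, _, _).
- by rewrite mxE !eqxx.
- apply/ffunP => x; rewrite ffunE.
  case: (eqVneq x w) => [->|ne_xw]; first by rewrite b0 // in_setD1 eqxx.
  by rewrite mxE eqxx (negPf ne_xw).
- apply/matrixP => x y; rewrite !mxE !in_set2.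
  case: ifP => [/orP[]|/norP[/norP[ne_xv ne_xw] /norP[ne_yv ne_yw]]].
  + by move=> vwx; rewrite idl.
  + by move=> vwy; rewrite idr.
  by rewrite (negPf ne_xv) (negPf ne_yv) (negPf ne_xw) (negPf ne_yw).
Qed.

Lemma card_symunit_leaf :
  #|symunit S z K| = (#|K| * #|symunit S z' K| +
    #|K|.-1 * #|K| ^ #|S|.-1 * #|symunit (S :\ v :\ w) z K|)%N.
Proof.
rewrite -card_symunit_column_nz -card_symunit_column_z.
rewrite -(cardsID [set M | column_nz M] (symunit S z K)); congr (_ + _)%N.
  by congr #|pred_of_set _|; apply/setP => M; rewrite in_setI [in RHS]in_set in_set.
by apply: eq_card => M; rewrite in_setD andbC [in RHS]in_set; congr (_ && ~~ _); rewrite in_set.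
Qed.
End Leaf.

(** Row [v] vanishes off the diagonal, so the matrix is the direct sum of a nonzero scalar and a
    form on [S :\ v]. *)
Lemma card_symunit_isolated (n : nat) (S : {set 'I_n}) (z : rel 'I_n)
    (K : finFieldType) (v : 'I_n) :
    v \in S -> {in S, forall x, z v x || z x v = (x != v)} ->
  #|symunit S z K| = (#|K|.-1 * #|symunit (S :\ v) z K|)%N.
Proof.
move=> Sv zv; have <- : #|[set~ 0 : K]| = #|K|.-1 by rewrite cardsC1.
(* Left multiplication by [diag_mx (d a)] scales row [v]; as that row is zero off the diagonal, only
   the entry [(v, v)] changes and symmetry is kept. *)
pose d (a : K) : 'rV[K]_n := \row_x if x == v then a else 1.
have ud a : (diag_mx (d a) \in unitmx) = (a != 0).
  rewrite unitmxE det_diag unitfE (bigD1 v) //= mxE eqxx big1 ?mulr1 //.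
  by move=> x ne_xv; rewrite mxE (negPf ne_xv).
have dE a (M : 'M[K]_n) x y :
    (diag_mx (d a) *m M) x y = (if x == v then a else 1) * M x y.
  by rewrite mul_diag_mx !mxE.
have neS (x : 'I_n) : x \notin S -> (x == v) = false.
  by move=> nSx; apply: contraNF nSx => /eqP->.
rewrite -cardsX.
have Mv M x : M \in symunit S z K -> x != v -> M x v = 0.
  case/symunitP=> symM _ pM idM ne_xv; have [Sx|nSx] := boolP (x \in S).
    by have := zv x Sx; rewrite ne_xv => /orP[] zvx; [rewrite symM|]; rewrite pM.
  by rewrite idM // (negPf ne_xv).
pose g (M : 'M[K]_n) := (M v v, diag_mx (d (M v v)^-1) *m M).
pose h (p : K * 'M[K]_n) := diag_mx (d p.1) *m p.2.
have dK a (M : 'M[K]_n) : a != 0 -> diag_mx (d a) *m (diag_mx (d a^-1) *m M) = M.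
  move=> nza; apply/matrixP => x y; rewrite !dE.
  by case: eqP => _; rewrite ?mul1r // mulVKf.
apply: (card_can_in (g := g) (h := h)) => [M zM|[a M]].
  have [symM uM pM idM] := symunitP _ _ _ zM.
  have nza : M v v != 0.
    apply/eqP => M0; have: M *m delta_mx v 0 = 0 :> 'cV_n.
      rewrite -colE; apply/colP => x; rewrite !mxE.
      by have [->//|ne_xv] := eqVneq x v; rewrite Mv.
    move/(congr1 (mulmx (invmx M))); rewrite mulKmx // mulmx0.
    by move/colP/(_ v); rewrite !mxE !eqxx => /eqP; rewrite oner_eq0.
  split; last exact: dK.
  rewrite in_setX in_setC1 nza /=; apply/symunitP; split.
  - move=> x y; rewrite !dE (symM y).
    case: (eqVneq x v) => [->|ne_xv]; case: (eqVneq y v) => [->|ne_yv] //.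
      by rewrite (symM v y) (Mv M y) ?mulr0.
    by rewrite (Mv M x) ?mulr0.
  - by rewrite unitmx_mul ud invr_eq0 nza.
  - move=> x y; rewrite !in_setD1 => /andP[_ Sx] /andP[_ Sy] zxy.
    by rewrite dE (pM x y) ?mulr0.
  - move=> x y; rewrite in_setD1 dE negb_and negbK.
    have [->|ne_xv /= nSx] := eqVneq x v; last by rewrite mul1r idM.
    have [->|ne_yv] := eqVneq y v; first by rewrite mulVf ?eqxx.
    by rewrite (symM v y) (Mv M y) ?mulr0.
rewrite in_setX in_setC1 => /andP[/= nza /symunitP[symM uM pM idM]].
have Mvx x : M v x = (v == x)%:R by rewrite idM // in_setD1 eqxx.
split; last first.
  rewrite /g /h /= dE eqxx Mvx eqxx mulr1; congr (_, _).
  by rewrite -{2}(invrK a) dK ?invr_eq0.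
apply/symunitP; rewrite /h /=; split.
- move=> x y; rewrite !dE; case: (eqVneq x v) => [->|]; case: (eqVneq y v) => [->|] //=.
  + by move=> ne_yv; rewrite (symM y) Mvx eq_sym (negPf ne_yv) !mulr0.
  + by move=> ne_xv; rewrite (symM x) Mvx eq_sym (negPf ne_xv) !mulr0.
  by rewrite symM.
- by rewrite unitmx_mul ud nza.
- move=> x y Sx Sy zxy; rewrite dE.
  have [exv|ne_xv] := eqVneq x v.
    have : y != v by rewrite -zv // -exv zxy.
    by rewrite exv Mvx eq_sym => /negPf ->; rewrite mulr0.
  have [eyv|ne_yv] := eqVneq y v; first by rewrite eyv symM Mvx eq_sym (negPf ne_xv) mulr0.
  by rewrite pM ?mulr0 // in_setD1 ?ne_xv ?ne_yv.
- move=> x y nSx; rewrite dE neS // mul1r idM //.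
  by rewrite in_setD1 (negPf nSx) andbF.
Qed.

(** * Polynomial point counts *)

Lemma polynomial_countD (N1 N2 : finFieldType -> nat) :
  polynomial_count N1 -> polynomial_count N2 ->
  polynomial_count (fun K => N1 K + N2 K)%N.
Proof.
move=> [p1 p1E] [p2 p2E]; exists (p1 + p2) => K.
by rewrite hornerD -p1E -p2E PoszD.
Qed.

Lemma polynomial_countM (N1 N2 : finFieldType -> nat) :
  polynomial_count N1 -> polynomial_count N2 ->
  polynomial_count (fun K => N1 K * N2 K)%N.
Proof.
move=> [p1 p1E] [p2 p2E]; exists (p1 * p2) => K.
by rewrite hornerM -p1E -p2E PoszM.
Qed.

Lemma eq_polynomial_count (N1 N2 : finFieldType -> nat) :
  (forall K, N1 K = N2 K) -> polynomial_count N1 -> polynomial_count N2.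
Proof. by move=> eqN [p pE]; exists p => K; rewrite -eqN. Qed.

Lemma polynomial_count1 : polynomial_count (fun=> 1%N).
Proof. by exists 1 => K; rewrite hornerC. Qed.

Lemma polynomial_count_exp (m : nat) : polynomial_count (fun K => #|K| ^ m)%N.
Proof. by exists 'X^m => K; rewrite hornerXn -!natz natrX. Qed.

Lemma polynomial_count_pred : polynomial_count (fun K => #|K|.-1).
Proof.
exists ('X - 1%:P) => K; rewrite hornerXsubC predn_int //.
by apply/card_gt0P; exists 0.
Qed.

(* The polynomial for q N takes at every prime q a value divisible by q, so q
   divides its constant term, which must be 0. *)
Lemma polynomial_count_divq (N1 N2 N : finFieldType -> nat) :
    (forall K, N1 K = #|K| * N K + N2 K)%N ->
    polynomial_count N1 -> polynomial_count N2 -> polynomial_count N.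
Proof.
move=> N1E [p1 p1E] [p2 p2E]; pose p := p1 - p2.
have pE (K : finFieldType) : p.[#|K|%:Z] = #|K|%:Z * (N K)%:Z.
  by rewrite hornerD hornerN -p1E -p2E N1E PoszD PoszM addrK.
(* Once [p.[0] = 0] is known, the quotient [r] is the polynomial for [N]. *)
have /factor_theorem[r pr] : root (p - p.[0]%:P) 0.
  by rewrite rootE hornerD hornerN hornerC subrr.
have {pr} prE x : p.[x] = r.[x] * x + p.[0].
  by rewrite -{1}[p](subrK p.[0]%:P) pr hornerD hornerC hornerM hornerXsubC subr0.
have p00 : p.[0] = 0.
  (* A prime larger than the absolute value of [p.[0]] can divide it only if it is 0. *)
  have [l lt_l pr_l] := prime_above `|p.[0]|%N.
  have := pE ('F_l : finFieldType); rewrite card_Fp // prE => p0E.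
  have : (l %| p.[0])%Z.
    apply/dvdzP; exists ((N ('F_l : finFieldType))%:Z - r.[l]).
    by rewrite mulrBl [(N _)%:Z * _]mulrC -p0E addrC addKr.
  rewrite /dvdz /= => l_dvd; apply/eqP; rewrite -absz_eq0 eqn0Ngt.
  by apply/negP => /dvdn_leq/(_ l_dvd); rewrite leqNgt lt_l.
exists r => K.
have /mulfI : #|K|%:Z != 0 by rewrite -lt0n; apply/card_gt0P; exists 0.
by apply; rewrite -pE prE p00 addr0 mulrC.
Qed.

(** The outer induction is on the size of [S], the inner one on the number of vertices of [S :\ v]
    not yet in the star of forced zeros at [v]. When the star is full, [v] splits off. *)
Lemma polynomial_count_symunit0 (n : nat) (S : {set 'I_n}) :
  polynomial_count (fun K => #|symunit S (fun _ _ => false) K|).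
Proof.
have [m] := ubnP #|S|; elim: m S => // m IHm S; rewrite ltnS => leSm.
have [->|[v Sv]] := set_0Vmem S.
  by apply: eq_polynomial_count polynomial_count1 => K; rewrite card_symunit0.
pose star (W : {set 'I_n}) : rel 'I_n := [rel x y | (x \in W) && (y == v)].
suff stars k (W : {set 'I_n}) : W \subset S :\ v -> (#|S :\ v :\: W| <= k)%N ->
    polynomial_count (fun K => #|symunit S (star W) K|).
  apply: eq_polynomial_count (stars #|S :\ v :\: set0| _ (sub0set _) (leqnn _)) => K.
  by congr #|pred_of_set _|; apply: eq_symunit => x y _ _; rewrite /star /= !in_set0.
elim: k W => [|k IHk] W sWS.
  rewrite leqn0 cards_eq0 setD_eq0 => sSW.
  have eWS : W = S :\ v by apply/eqP; rewrite eqEsubset sWS.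
  apply: (eq_polynomial_count (N1 := fun K : finFieldType =>
      #|K|.-1 * #|symunit (S :\ v) (star W) K|)%N) => [K|].
    rewrite (@card_symunit_isolated _ S (star W) K v) // => x Sx.
    by rewrite /star /= eWS !in_setD1 !eqxx Sx /= !andbT.
  apply: polynomial_countM polynomial_count_pred _.
  apply: eq_polynomial_count (IHm (S :\ v) _) => [K|]; last first.
    by move: leSm; rewrite (cardsD1 v) Sv.
  congr #|pred_of_set _|; apply: eq_symunit => x y; rewrite !in_setD1.
  by move=> /andP[/negPf nxv _] /andP[/negPf nyv _]; rewrite /star /= nxv nyv !andbF.
move=> le_k; have [eWS|[w]] := set_0Vmem (S :\ v :\: W).
  by apply: IHk; rewrite ?eWS ?cards0.
move=> SvWw; have /setDP[/setD1P[ne_wv Sw] nWw] := SvWw.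
(* Here [w], being outside the star, is the unrestricted vertex and the centre [v] is its partner.
   The exponent 1 puts the factor q in the form of [polynomial_count_exp]. *)
apply: (eq_polynomial_count (N1 := fun K : finFieldType =>
    #|K| ^ 1 * #|symunit S (star (w |: W)) K| +
    #|K|.-1 * #|K| ^ #|S|.-1 * #|symunit (S :\ w :\ v) (star W) K|)%N) => [K|].
  rewrite (@card_symunit_leaf _ S (star W) K w v) //; last first.
    by move=> x Sx; rewrite /star /= (negPf nWw) (negPf ne_wv) andbF.
  rewrite expn1; congr (_ * #|pred_of_set _| + _)%N.
  apply: eq_symunit => x y _ _; rewrite /star /= !in_setU1.
  by case: (x == w); case: (y == w); case: (x == v); case: (y == v);
    rewrite /= ?andbT ?andbF ?orbT ?orbF.
apply: polynomial_countD; apply: polynomial_countM.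
- exact: polynomial_count_exp.
- apply: IHk; first by rewrite subUset sub1set in_setD1 ne_wv Sw.
  rewrite -ltnS; apply: leq_trans le_k; apply: proper_card.
  apply/properP; split; first exact: setDS (subsetUr _ _).
  by exists w; rewrite // in_setD in_setU1 eqxx.
- apply: polynomial_countM polynomial_count_pred _.
  exact: polynomial_count_exp.
- apply: eq_polynomial_count (IHm (S :\ w :\ v) _) => [K|]; last first.
    move: leSm; rewrite (cardsD1 w S) Sw; apply: leq_trans.
    by rewrite add1n ltnS subset_leq_card ?subsetDl.
  congr #|pred_of_set _|; apply: eq_symunit => x y; rewrite !in_setD1.
  by move=> /andP[/negPf nxv _] /andP[/negPf nyv _]; rewrite /star /= nxv nyv !andbF.
Qed.

(** * Leaves, and induction on the edges of a forest *)

Lemma forest_leaf (T : finType) (f : rel T) (x y : T) :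
    simple_graph f -> forest f -> f x y ->
  exists v w, f v w /\ forall u, f v u -> u = w.
Proof.
move=> [symf irrf] /forestP acy fxy.
have [|noleaf] := boolP [exists v, exists w, f v w && [forall u, f v u ==> (u == w)]].
  case/existsP=> v /existsP[w /andP[fvw /forallP leaf]].
  by exists v, w; split=> // u fvu; apply/eqP; apply: (implyP (leaf u)).
(* Without a leaf, every simple path extends at its start, and eventually has more vertices than
   [T]. *)
suff long k : exists a b p, [/\ path f a (b :: p), uniq [:: a, b & p] & size p = k].
  have [a [b [p [_ /card_uniqP Up sz_p]]]] := long #|T|.
  have := max_card [in [:: a, b & p]]; rewrite Up /= sz_p ltnNge.
  by rewrite leqnSn.
elim: k => [|k [a [b [p [fp Up sz_p]]]]].
  exists x, y, [::]; split=> //=; rewrite ?fxy ?in_nil ?andbT // mem_seq1.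
  by apply: contraTneq fxy => ->; rewrite irrf.
have [c fac ne_cb] : exists2 c, f a c & c != b.
  move: noleaf; rewrite negb_exists => /forallP/(_ a).
  rewrite negb_exists => /forallP/(_ b); have /= /andP[-> _] := fp.
  rewrite negb_forall => /existsP[c]; rewrite negb_imply => /andP[fac ne_cb].
  by exists c.
exists c, a, (b :: p); rewrite /= sz_p; split=> //=.
  by rewrite symf fac.
rewrite -[X in _ && X]/(uniq [:: a, b & p]) Up andbT !in_cons (negPf ne_cb) /=.
apply/norP; split; first by apply: contraTneq fac => ->; rewrite irrf.
(* If [c] is already on the path, the piece from [a] to [c] closes to a cycle, of length at least
   three because [c] differs from [b]. *)
apply/negP => pc; case/splitPr: pc fp Up => p1 p2 fp Up.
apply: (acy [:: a, b & rcons p1 c]); first by rewrite /= size_rcons.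
rewrite /ucycle; apply/andP; split; last first.
  by move: Up; rewrite -cat_rcons -!cat_cons cat_uniq => /andP[].
move: fp; rewrite -cat_rcons -cat_cons cat_path => /andP[fp _].
by rewrite /path.cycle rcons_path fp /= last_rcons symf.
Qed.

Lemma sub_forest (T : finType) (f g : rel T) :
  subrel g f -> forest f -> forest g.
Proof.
move=> sgf /forestP acy; apply/forestP => c c2 /andP[gc Uc].
by apply: (acy c c2); rewrite /ucycle (sub_cycle sgf gc).
Qed.

(** Induction on the number of ordered pairs in [S] related by [f]. Deleting a leaf edge gives [g],
    whose recursion contains the count for [f] multiplied by q; [polynomial_count_divq] solves for
    it. *)
Lemma polynomial_count_symunit (n : nat) (S : {set 'I_n}) (f : rel 'I_n) :
  simple_graph f -> forest f -> polynomial_count (fun K => #|symunit S f K|).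
Proof.
pose E (A : {set 'I_n}) (g : rel 'I_n) :=
  [set p : 'I_n * 'I_n | [&& p.1 \in A, p.2 \in A & g p.1 p.2]].
have [m] := ubnP #|E S f|; elim: m S f => // m IHm S f; rewrite ltnS => leEm.
move=> [symf irrf] acyf.
have [E0|[[x y]]] := set_0Vmem (E S f).
  apply: eq_polynomial_count (polynomial_count_symunit0 S) => K.
  congr #|pred_of_set _|; apply: eq_symunit => a b Sa Sb.
  have nE c d : c \in S -> d \in S -> f c d = false.
    by move=> Sc Sd; have := in_set0 (c, d); rewrite -E0 inE /= Sc Sd.
  by rewrite !nE.
rewrite inE /= => /and3P[Sx Sy fxy].
(* The leaf is sought in the restriction to [S]; it may have further [f]-neighbours outside [S]. *)
pose fS := [rel a b | [&& a \in S, b \in S & f a b]].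
have [v [w [/and3P[Sv Sw fvw] leaf]]] :
    exists v w, fS v w /\ forall u, fS v u -> u = w.
  apply: (@forest_leaf _ fS x y); last by rewrite /= Sx Sy.
    by split=> [a b|a] /=; rewrite ?irrf ?andbF // symf andbCA.
  by apply: sub_forest acyf => a b /and3P[].
have ne_vw : v != w by apply: contraTneq fvw => ->; rewrite irrf.
pose vw : rel 'I_n := [rel a b | (a == v) && (b == w)].
pose g := [rel a b | f a b && ~~ (vw a b || vw b a)].
have sgf : subrel g f by move=> a b /andP[].
have gG : simple_graph g.
  by split=> [a b|a] /=; rewrite ?irrf // symf orbC.
have acyg : forest g by apply: sub_forest acyf.
have ltE (A : {set 'I_n}) : A \subset S -> (#|E A g| < #|E S f|)%N.
  move=> sAS; apply: proper_card; apply/properP; split.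
    apply/subsetP => -[a b]; rewrite !inE /= => /and3P[Aa Ab /andP[-> _]].
    by rewrite !(subsetP sAS).
  by exists (v, w); rewrite !inE /= ?Sv ?Sw ?fvw // /vw /= !eqxx !andbF.
have PE (A : {set 'I_n}) : A \subset S -> polynomial_count (fun K => #|symunit A g K|).
  by move=> sAS; apply: IHm => //; apply: leq_trans (ltE A sAS) leEm.
apply: (polynomial_count_divq (N1 := fun K => #|symunit S g K|)
    (N2 := fun K => (#|K|.-1 * #|K| ^ #|S|.-1 * #|symunit (S :\ v :\ w) g K|)%N)).
- move=> K; rewrite (@card_symunit_leaf _ S g K v w) //; last first.
    move=> a Sa; have fvaw : f v a -> a = w.
      by move=> fva; apply: leaf; rewrite /= Sv Sa.
    have ngva : ~~ g v a.
      by apply/negP => /andP[/fvaw->]; rewrite /vw /= !eqxx.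
    by apply/andP; split; last rewrite gG.1; exact: ngva.
  congr (_ * #|pred_of_set _| + _)%N; apply: eq_symunit => a b _ _ /=.
  rewrite (symf b) orbb; have fvwE c d : vw c d -> f c d.
    by case/andP=> /eqP-> /eqP->.
  have := fvwE a b; have := fvwE b a; rewrite (symf b) /vw /=.
  by case: ((a == v) && _); case: ((b == v) && _); case: (f a b) => //= h1 h2;
    by [have := h1 isT | have := h2 isT].
- exact: PE.
- apply: polynomial_countM; last exact: PE (subset_trans (subsetDl _ _) (subsetDl _ _)).
  exact: polynomial_countM polynomial_count_pred (polynomial_count_exp _).
Qed.

(** * The matrix-tree theorem *)

Lemma eq_set2 (T : finType) (a b c d : T) :
  [set a; b] = [set c; d] -> a = c /\ b = d \/ a = d /\ b = c.
Proof.
move=> eq_set; have : a \in [set c; d] by rewrite -eq_set set21.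
have : b \in [set c; d] by rewrite -eq_set set22.
have : c \in [set a; b] by rewrite eq_set set21.
have : d \in [set a; b] by rewrite eq_set set22.
by rewrite !in_set2 => /orP[]/eqP? /orP[]/eqP? /orP[]/eqP? /orP[]/eqP?; subst; auto.
Qed.

(** Parent maps encode trees rooted at [r]: [p i] is the next vertex on the way to [r], and the root
    is its own parent to make [p] total. *)
Definition rooted (T : finType) (r : T) (p : T -> T) : bool :=
  (p r == r) && [forall i, fconnect p i r].

Definition parent_edges (T : finType) (e : rel T) (r : T) (p : T -> T) :
    {set edge e} :=
  [set a | [exists i, (i != r) && (val a == [set i; p i])]].

(** The depth is the least number of steps of [p] leading to [r]. *)
Lemma rooted_depth (T : finType) (r : T) (p : T -> T) :
  rooted r p -> exists d : T -> nat, forall i, i != r -> (d (p i) < d i)%N.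
Proof.
case/andP=> _ /forallP reach.
have ex i : exists k, iter k p i == r.
  by exists (findex p i r); rewrite iter_findex.
exists (fun i => ex_minn (ex i)) => i ne_ir.
case: ex_minnP => k _ min_k; case: ex_minnP => [[|l]] /=; first by rewrite (negPf ne_ir).
by rewrite -iterS iterSr => /min_k; rewrite ltnS.
Qed.

(** * Spanning trees as parent maps *)

Section Trees.
Variables (T : finType) (e : rel T) (r : T).
Hypothesis eG : simple_graph e.

Let parents (p : T -> T) := forall i, i != r -> e i (p i).

Lemma edge_mem (x y : T) : ([set x; y] \in edge_set e) = e x y.
Proof.
rewrite inE; apply/existsP/idP => [[a /existsP[b /andP[eab /eqP/eq_set2]]]|exy].
  by case=> [[-> ->]|[-> ->]] //; rewrite eG.1.
by exists x; apply/existsP; exists y; rewrite exy eqxx.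
Qed.

Lemma span_rel_sym (A : {set edge e}) : symmetric (span_rel A).
Proof. by move=> x y; rewrite /span_rel /= eq_sym setUC. Qed.

Lemma span_relE (A : {set edge e}) (a : edge e) (x y : T) :
  val a = [set x; y] -> span_rel A x y = (a \in A).
Proof.
move=> va; have ne_xy : x != y.
  by apply: contraTneq (valP a) => eq_xy; rewrite va eq_xy edge_mem eG.2.
rewrite /span_rel /= ne_xy; apply/exists_inP/idP => [[b Ab /eqP vb]|Aa].
  by rewrite -(val_inj (etrans vb (esym va))).
by exists a => //; apply/eqP.
Qed.

Lemma span_relP (A : {set edge e}) (x y : T) :
  reflect (exists2 a, a \in A & val a = [set x; y]) (span_rel A x y).
Proof.
apply: (iffP idP) => [/andP[_ /exists_inP[a Aa /eqP va]]|[a Aa va]].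
  by exists a.
by rewrite (span_relE _ va).
Qed.

Lemma edgeP (x y : T) : e x y -> exists a : edge e, val a = [set x; y].
Proof. by rewrite -edge_mem => exy; exists (exist _ [set x; y] exy). Qed.

Lemma span_parent_edges (p : T -> T) (x y : T) : parents p ->
  span_rel (parent_edges e r p) x y =
    (x != r) && (p x == y) || (y != r) && (p y == x).
Proof.
move=> ep; apply/span_relP/orP => [[a]|].
  rewrite inE => /existsP[i /andP[ne_ir /eqP ->]] /eq_set2[[<- <-]|[<- <-]].
    by left; rewrite ne_ir eqxx.
  by right; rewrite ne_ir eqxx.
have par i : i != r -> exists2 a, a \in parent_edges e r p & val a = [set i; p i].
  move=> ne_ir; have [a va] := edgeP (ep i ne_ir); exists a => //.
  by rewrite inE; apply/existsP; exists i; rewrite ne_ir va eqxx.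
case=> /andP[/par[a pa va] /eqP <-]; exists a => //.
by rewrite setUC.
Qed.

Lemma connected_parent_edges (p : T -> T) :
  rooted r p -> parents p -> connected (span_rel (parent_edges e r p)).
Proof.
move=> /andP[_ /forallP reach] ep; set s := span_rel _.
have csym : connect_sym s by apply: sym_connect_sym; apply: span_rel_sym.
have to_r x : connect s x r.
  have: connect (frel p) x r by apply: reach.
  case/connectP=> q; elim: q x => [|y q IHq] x /=; first by move=> _ ->.
  case/andP=> /eqP pxy fq eq_r.
  have [->|ne_xr] := eqVneq x r; first exact: connect0.
  apply: connect_trans (IHq y fq eq_r); apply: connect1.
  by rewrite /s span_parent_edges // ne_xr pxy eqxx.
apply/forallP => x; apply/forallP => y; apply: connect_trans (to_r x) _.
by rewrite csym.
Qed.

Lemma forest_parent_edges (p : T -> T) :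
  rooted r p -> parents p -> forest (span_rel (parent_edges e r p)).
Proof.
move=> rp ep; have [d dP] := rooted_depth rp; set s := span_rel _.
apply/forestP => c c2 /andP[sc Uc].
have [i0 ci0] : exists i0, i0 \in c by case: c c2 {sc Uc} => // i c _; exists i; rewrite inE eqxx.
(* The two neighbours on a cycle of its deepest vertex i would both be p i. *)
have [i ci max_i] := @arg_maxnP _ i0 (mem c) d ci0.
have nbr j : j \in c -> s i j -> j = p i.
  move=> cj; rewrite /s span_parent_edges // => /orP[/andP[_ /eqP//]|].
  case/andP=> ne_jr /eqP pj; have := dP j ne_jr.
  by rewrite pj ltnNge => /negP[]; apply: max_i.
have [k q cE] := rot_to ci; have sz_q : (1 < size q)%N.
  by rewrite -ltnS -[(size q).+1]/(size (i :: q)) -cE size_rot.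
have sq : path.cycle s (i :: q) by rewrite -cE rot_cycle.
have Uq : uniq (i :: q) by rewrite -cE rot_uniq.
have qc j : j \in q -> j \in c by move=> qj; rewrite -(mem_rot k) cE inE qj orbT.
case: q {cE} sz_q sq Uq qc => [//|j q]; case/lastP: q => [//|q l] _.
rewrite /path.cycle rcons_path /= rcons_path last_rcons.
case/andP=> /and3P[sij _ _] sli /and3P[_ nql _] qc.
have jE : j = p i by apply: nbr; rewrite ?qc ?inE ?eqxx.
have lE : l = p i.
  by apply: nbr; rewrite ?qc ?inE ?mem_rcons ?inE ?eqxx ?orbT // /s span_rel_sym.
by move: nql; rewrite jE -lE mem_rcons mem_head.
Qed.

Lemma spanning_tree_parent_edges (p : T -> T) :
  rooted r p -> parents p -> spanning_tree (parent_edges e r p).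
Proof.
by move=> rp ep; rewrite /spanning_tree connected_parent_edges ?forest_parent_edges.
Qed.

(** Induction on the depth for [p2]. The edge from [i] to [p2 i] lies in the tree of [p1], so
    otherwise [p1 (p2 i) = i]; by induction [p2 (p2 i) = i], which contradicts the decrease of
    depth. *)
Lemma parent_edges_inj (p1 p2 : T -> T) :
    rooted r p1 -> rooted r p2 -> parents p1 -> parents p2 ->
  parent_edges e r p1 = parent_edges e r p2 -> p1 =1 p2.
Proof.
move=> rp1 rp2 ep1 ep2 eqA i; have [d dP] := rooted_depth rp2.
have [m] := ubnP (d i); elim: m i => // m IHm i; rewrite ltnS => le_dm.
have [->|ne_ir] := eqVneq i r.
  by case/andP: rp1 => /eqP-> _; case/andP: rp2 => /eqP-> _.
have lt_d := dP i ne_ir.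
have : span_rel (parent_edges e r p1) i (p2 i).
  by rewrite eqA span_parent_edges // ne_ir eqxx.
rewrite span_parent_edges // => /orP[/andP[_ /eqP//]|/andP[ne_pr /eqP]].
rewrite (IHm _ (leq_trans lt_d le_dm)) => ppi; have := dP _ ne_pr.
by rewrite ppi ltnNge ltnW.
Qed.

(** The parent of [i] is a neighbour closer to [r] in the graph of [A]. The resulting edges lie in
    [A] and already connect all vertices, so a further edge of [A] would close a cycle. *)
Lemma spanning_tree_parents (A : {set edge e}) : spanning_tree A ->
  exists p : {ffun T -> T}, [/\ rooted r p, parents p & parent_edges e r p = A].
Proof.
case/andP=> /forallP cA /forestP acyA; set s := span_rel A.
have ex i : exists k, [exists q : k.-tuple T, path s i q && (last i q == r)].
  have /connectP[q sq rE] := forallP (cA i) r.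
  exists (size q); apply/existsP; exists (in_tuple q).
  by rewrite sq -rE eqxx.
pose d i := ex_minn (ex i).
have closer i : i != r -> exists j, s i j && (d j < d i)%N.
  move=> ne_ir; rewrite {2}/d; case: ex_minnP => k /existsP[t /andP[]] + + _.
  case: (tval t) (size_tuple t) => [|j q] /= sz_q; first by rewrite (negPf ne_ir).
  move=> /andP[sij sq] lastq; exists j; rewrite sij -sz_q ltnS /d.
  case: ex_minnP => l _; apply; apply/existsP; exists (in_tuple q).
  by rewrite sq.
(* At [i = r] no [j] qualifies, so the default gives [p r = r]. *)
pose p := [ffun i => odflt r [pick j | (i != r) && (s i j && (d j < d i)%N)]].
have pP i : i != r -> s i (p i) /\ (d (p i) < d i)%N.
  move=> ne_ir; rewrite ffunE ne_ir /=; case: pickP => [j /andP[]|noj]; first by split.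
  by have [k] := closer i ne_ir; rewrite noj.
have pr : p r = r by rewrite ffunE; case: pickP => // j; rewrite eqxx.
have se x y : s x y -> e x y.
  by case/span_relP=> a _ va; rewrite -edge_mem -va; apply: valP.
have ep : parents p by move=> i /pP[/se].
have rp : rooted r p.
  apply/andP; split; first exact/eqP.
  apply/forallP => i; have [m] := ubnP (d i).
  elim: m i => // m IHm i; rewrite ltnS => le_dm.
  have [->|ne_ir] := eqVneq i r; first exact: connect0.
  apply: connect_trans (fconnect1 _ _) (IHm _ _).
  exact: leq_trans (pP i ne_ir).2 le_dm.
exists p; split=> //; apply/setP => a.
have sub : subrel (span_rel (parent_edges e r p)) s.
  move=> x y; rewrite span_parent_edges // => /orP[]/andP[/pP[spi _] /eqP<-] //.
  by rewrite /s span_rel_sym.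
have /existsP[x /existsP[y /andP[exy /eqP va]]] : [exists x, exists y, e x y && (val a == [set x; y])].
  by have := valP a; rewrite inE.
rewrite -!(span_relE _ va); apply/idP/idP => [/sub //|sxy].
apply: contraT => nsxy.
have /forallP/(_ x)/forallP/(_ y)/connectP[q0] := connected_parent_edges rp ep.
case/shortenP=> q pq Uq _ yE; case: (acyA (x :: q)).
  case: q pq Uq yE => [_ _ yx|z [|//]].
    by move: exy; rewrite yx eG.2.
  by rewrite /= andbT => sxz _ yz; rewrite yz sxz in nsxy.
rewrite /ucycle Uq andbT /path.cycle rcons_path -yE -/s (sub_path sub pq).
by rewrite /s span_rel_sym.
Qed.
End Trees.

Section EdgeWeights.
Variables (T : finType) (e : rel T) (R : comNzRingType).
Hypothesis eG : simple_graph e.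

(** The weighted adjacency matrix of the point [x]. *)
Definition weight (x : {ffun edge e -> R}) (i j : T) : R :=
  if insub [set i; j] is Some a then x a else 0.

Lemma weightE (x : {ffun edge e -> R}) (a : edge e) (i j : T) :
  val a = [set i; j] -> weight x i j = x a.
Proof. by move=> va; rewrite /weight -va valK. Qed.

Lemma weight0 (x : {ffun edge e -> R}) (i j : T) : ~~ e i j -> weight x i j = 0.
Proof.
by move=> nij; rewrite /weight insubN // edge_mem.
Qed.

Lemma weight_sym (x : {ffun edge e -> R}) (i j : T) :
  weight x i j = weight x j i.
Proof. by rewrite /weight setUC. Qed.

Lemma weightii (x : {ffun edge e -> R}) (i : T) : weight x i i = 0.
Proof. by rewrite weight0 // eG.2. Qed.

(** Each tree edge has a unique tail: two different tails would be each other's parents, which the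
    depth forbids. *)
Lemma prod_parent_edges (x : {ffun edge e -> R}) (r : T) (p : T -> T) :
    rooted r p -> (forall i, i != r -> e i (p i)) ->
  \prod_(a in parent_edges e r p) x a = \prod_(i | i != r) weight x i (p i).
Proof.
move=> rp ep; have [d dP] := rooted_depth rp.
pose tail (a : edge e) := odflt r [pick i | (i != r) && (val a == [set i; p i])].
have tailP a : a \in parent_edges e r p ->
    tail a != r /\ val a = [set tail a; p (tail a)].
  rewrite inE /tail => /existsP va; case: pickP => [i /andP[ne_ir /eqP] //|noi].
  by case: va => i; rewrite noi.
rewrite (eq_bigr (fun a => weight x (tail a) (p (tail a)))); last first.
  by move=> a /tailP[_ va]; rewrite (weightE _ va).
rewrite -(big_imset (fun i => weight x i (p i))) /=; last first.
  move=> a b /tailP[_ va] /tailP[_ vb] eq_t.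
  by apply: val_inj; rewrite va vb eq_t.
apply: eq_bigl => i; apply/imsetP/idP => [[a /tailP[ne_tr _] ->] //|ne_ir].
have [a va] := edgeP eG (ep i ne_ir).
have pa : a \in parent_edges e r p.
  by rewrite inE; apply/existsP; exists i; rewrite ne_ir va eqxx.
exists a => //; have [ne_tr] := tailP a pa.
rewrite va => /eq_set2[[]//|[it pit]].
have := dP i ne_ir; have := dP _ ne_tr.
by rewrite pit -it => lt1 lt2; have := ltn_trans lt1 lt2; rewrite ltnn.
Qed.
End EdgeWeights.

(** * Determinants of Laplacians *)

(* The row of L at i is the w i-weighted sum of the rows e_i - e_j, so its
   determinant is a weighted sum over the maps i |-> j. *)
Lemma det_weighted_rows (R : comNzRingType) (n : nat) (w : 'I_n -> 'I_n -> R)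
    (g : 'I_n -> 'I_n -> 'I_n -> R) :
  \det (\matrix_(i, k) \sum_j w i j * g i j k) =
  \sum_(p : {ffun 'I_n -> 'I_n})
    \prod_i w i (p i) * \det (\matrix_(i, k) g i (p i) k).
Proof.
under [RHS]eq_bigr do rewrite mulr_sumr.
rewrite exchange_big /=; apply: eq_bigr => s _.
under eq_bigr do rewrite mxE.
rewrite bigA_distr_bigA mulr_sumr; apply: eq_bigr => p _.
rewrite big_split mulrCA; congr (_ * (_ * _)).
by apply: eq_bigr => i _; rewrite mxE.
Qed.

(** For [p r = r] this is the Laplacian of the digraph with arrows from [i] to [p i], with row and
    column [r] replaced by those of the identity. *)
Definition map_laplacian (R : comNzRingType) (n : nat) (r : 'I_n)
    (p : 'I_n -> 'I_n) : 'M[R]_n :=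
  \matrix_(i, k) ((i == k)%:R - ((p i == k) && (p i != r))%:R).

Lemma det_map_laplacian (R : comNzRingType) (n : nat) (r : 'I_n)
    (p : 'I_n -> 'I_n) :
  p r = r -> \det (map_laplacian R r p) = (rooted r p)%:R.
Proof.
move=> pr; have [rp|] := boolP (rooted r p).
  have [d dP] := rooted_depth rp.
  have p_ne i : i != r -> (p i == i) = false.
    by move=> ne_ir; apply: contraTF (dP i ne_ir) => /eqP->; rewrite ltnn.
  rewrite /determinant (bigD1 (1%g : 'S_n)) //= odd_perm1 expr0 mul1r.
  rewrite [X in X + _]big1 => [|i _]; last first.
    rewrite mxE perm1 eqxx; have [->|/p_ne ->] := eqVneq i r.
      by rewrite pr eqxx subr0.
    by rewrite subr0.
  rewrite big1 ?addr0 // => s ne_s1.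
  (* A nonzero term would follow p along a nontrivial cycle of s. *)
  have [i0 ne_si0] : exists i, s i != i.
    apply/existsP; apply: contraR ne_s1; rewrite negb_exists => /forallP fix_s.
    by apply/eqP/permP => i; rewrite perm1; apply/eqP; rewrite -[_ == _]negbK.
  have [i ne_si max_i] := @arg_minnP _ i0 (fun i => s i != i) d ne_si0.
  rewrite (bigD1 i) //= mxE eq_sym (negPf ne_si).
  case: eqP => [psi|]; last by rewrite subr0 mul0r mulr0.
  have [->|ne_ir] := eqVneq i r.
    by rewrite pr eqxx subr0 mul0r mulr0.
  have: (d i <= d (s i))%N by apply: max_i; rewrite inj_eq //; apply: perm_inj.
  by rewrite -psi leqNgt dP.
rewrite /rooted pr eqxx negb_forall => /existsP[i0 ni0].
(* The indicator of the vertices that never reach [r] is a kernel vector. *)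
pose u : 'cV[R]_n := \col_i (~~ fconnect p i r)%:R.
have Lu0 : map_laplacian R r p *m u = 0.
  apply/colP => i; rewrite !mxE; under eq_bigr do rewrite !mxE mulrBl.
  rewrite sumrB (bigD1 i) //= eqxx mul1r big1 => [|k ne_ki]; last first.
    by rewrite eq_sym (negPf ne_ki) mul0r.
  rewrite (bigD1 (p i)) //= eqxx big1 => [|k ne_kp]; last first.
    by rewrite eq_sym (negPf ne_kp) mul0r.
  rewrite !addr0; have [pir|ne_pr] := eqVneq (p i) r.
    by rewrite mul0r subr0 -pir fconnect1.
  suff -> : fconnect p i r = fconnect p (p i) r by rewrite mul1r subrr.
  apply/idP/idP => [|/(connect_trans (fconnect1 p i)) //].
  case/connectP=> -[/= _ ri|y q /= /andP[/eqP <-] pq rE]; last by apply/connectP; exists q.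
  by rewrite -ri pr eqxx in ne_pr.
(* As [R] may have zero divisors, the adjugate is used: it gives [\det L * u = 0], and [u] has the
   entry 1 at [i0]. *)
have := congr1 (mulmx (\adj (map_laplacian R r p))) Lu0.
rewrite mulmxA mul_adj_mx mulmx0 mul_scalar_mx => /colP/(_ i0).
by rewrite !mxE ni0 mulr1.
Qed.

(** Row and column [r] are made trivial instead of deleted, matching the convention of [symunit];
    the diagonal sums still include the edges to [r]. *)
Definition reduced_laplacian (n : nat) (e : rel 'I_n) (R : comNzRingType)
    (r : 'I_n) (x : {ffun edge e -> R}) : 'M[R]_n :=
  \matrix_(i, k) if (i == r) || (k == r) then (i == k)%:R
                 else if i == k then \sum_j weight x i j else - weight x i k.

Lemma matrix_tree (n : nat) (e : rel 'I_n) (R : comNzRingType) (r : 'I_n)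
    (x : {ffun edge e -> R}) :
  simple_graph e -> \det (reduced_laplacian r x) = Q x.
Proof.
(* The weights in row [r] kill every map that moves [r]. *)
move=> eG; pose w i j := if i == r then (j == r)%:R else weight x i j.
have -> : reduced_laplacian r x = \matrix_(i, k)
    \sum_j w i j * ((i == k)%:R - ((j == k) && (j != r))%:R).
  apply/matrixP => i k; rewrite !mxE /w.
  have [->|ne_ir] /= := eqVneq i r.
    rewrite (bigD1 r) //= eqxx andbF subr0 mul1r big1 ?addr0 // => j ne_jr.
    by rewrite (negPf ne_jr) mul0r.
  have [->|ne_kr] := eqVneq k r.
    rewrite (negPf ne_ir) big1 // => j _.
    by case: eqP => //= _; rewrite subr0 mulr0.
  have [<-|ne_ik] := eqVneq i k.
    apply: eq_bigr => j _; have [->|_] := eqVneq j i.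
      by rewrite weightii // mul0r.
    by rewrite subr0 mulr1.
  rewrite (bigD1 k) //= eqxx ne_kr sub0r mulrN1 big1 ?addr0 // => j ne_jk.
  by rewrite (negPf ne_jk) subr0 mulr0.
rewrite det_weighted_rows.
pose good := [set p : {ffun 'I_n -> 'I_n} | rooted r p &&
  [forall i, (i != r) ==> e i (p i)]].
have goodP p : p \in good -> rooted r p /\ forall i, i != r -> e i (p i).
  by rewrite inE => /andP[rp /forallP ep]; split=> // i; apply/implyP.
(* A map outside [good] moves [r], or is not rooted and has determinant 0, or uses a non-edge, of
   weight 0. *)
rewrite (bigID (mem good)) /= [X in _ + X]big1 ?addr0 => [|p]; last first.
  rewrite inE negb_and.
  have [pr|ne_pr] := eqVneq (p r) r; last first.
    by rewrite (bigD1 r) //= /w eqxx (negPf ne_pr) !mul0r.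
  case/orP=> [nrp|].
    by rewrite (det_map_laplacian R pr) (negPf nrp) mulr0.
  rewrite negb_forall => /existsP[i]; rewrite negb_imply => /andP[ne_ir nei].
  by rewrite (bigD1 i) //= /w (negPf ne_ir) weight0 // !mul0r.
rewrite /Q (eq_bigl (mem [set parent_edges e r p | p : {ffun 'I_n -> 'I_n} in good])).
  rewrite big_imset /=.
    apply: eq_bigr => p /goodP[rp ep].
    have pr : p r = r by case/andP: rp => /eqP.
    rewrite (det_map_laplacian R pr) rp mulr1 (prod_parent_edges eG _ rp ep).
    rewrite (bigD1 r) //= /w eqxx pr eqxx mul1r.
    by apply: eq_bigr => i /negPf ->.
  move=> p1 p2 /goodP[rp1 ep1] /goodP[rp2 ep2] eqA; apply/ffunP.
  exact: (parent_edges_inj eG rp1 rp2 ep1 ep2 eqA).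
move=> A; apply/idP/imsetP => [/(spanning_tree_parents r eG)[p [rp ep pA]]|].
  exists p; last by rewrite pA.
  by rewrite inE rp; apply/forallP => i; apply/implyP/ep.
by case=> p /goodP[rp ep] ->; apply: spanning_tree_parent_edges.
Qed.

(** * The reduced Laplacian at an isolated vertex of the forest *)

Lemma card_X_symunit (n : nat) (r : 'I_n) (f : rel 'I_n) (K : finFieldType) :
    simple_graph f -> (forall i, ~~ f r i) ->
  #|X (complete_minus f) K| = #|symunit (setT :\ r) f K|.
Proof.
move=> [symf irrf] nfr; set e := complete_minus f.
have eE i j : e i j = (i != j) && ~~ f i j by [].
have eG : simple_graph e.
  by split=> [i j|i]; rewrite !eE ?eqxx // eq_sym symf.
pose rowsum (M : 'M[K]_n) i := \sum_(k | k != r) M i k.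
(* In a row of the full Laplacian the entries sum to 0, so the weight of an edge at [r] is the sum
   of a reduced row. *)
pose coef (M : 'M[K]_n) i j :=
  if j == r then rowsum M i else if i == r then rowsum M j else - M i j.
(* An arbitrary ordering of the two endpoints is picked; for symmetric [M] the value does not depend
   on it. The default 0 is never reached. *)
pose h (M : 'M[K]_n) : {ffun edge e -> K} :=
  [ffun a => if [pick q | e q.1 q.2 && (val a == [set q.1; q.2])] is Some q
             then coef M q.1 q.2 else 0].
have coefL (x : {ffun edge e -> K}) i j :
    e i j -> coef (reduced_laplacian r x) i j = weight x i j.
  have rowL k : k != r -> rowsum (reduced_laplacian r x) k = weight x k r.
    move=> ne_kr; rewrite /rowsum (bigD1 k) //= mxE (negPf ne_kr) eqxx /=.
    rewrite (bigD1 r) //= (bigD1 k) //= weightii // add0r -addrA -big_split /=.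
    by rewrite big1 ?addr0 // => l /andP[ne_lr ne_lk];
       rewrite mxE (negPf ne_kr) (negPf ne_lr) /= eq_sym (negPf ne_lk) subrr.
  rewrite eE /coef => /andP[ne_ij _].
  have [eq_jr|ne_jr] := eqVneq j r; first by rewrite eq_jr in ne_ij *; apply: rowL.
  have [->|ne_ir] := eqVneq i r; first by rewrite weight_sym; apply: rowL.
  by rewrite mxE (negPf ne_ir) (negPf ne_jr) (negPf ne_ij) opprK.
have hE M i j : M^T = M -> e i j -> weight (h M) i j = coef M i j.
  move=> symM eij; have coef_sym k l : k != l -> coef M k l = coef M l k.
    rewrite /coef; have [->|ne_kr] := eqVneq k r; have [->|ne_lr] := eqVneq l r => // _.
    by rewrite -[in LHS]symM mxE.
  have [a va] := edgeP eG eij; rewrite (weightE _ va) ffunE.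
  case: pickP => [[k l] /= /andP[ekl]|/(_ (i, j))]; last by rewrite /= eij va eqxx.
  rewrite va => /eqP/eq_set2[[-> ->] //|[-> ->]].
  by apply: coef_sym; move: ekl; rewrite eE => /andP[].
apply: (card_can_in (g := @reduced_laplacian n e K r) (h := h)) => [x|M].
  rewrite inE => Qx; split; last first.
    apply/ffunP => a; rewrite ffunE; case: pickP => [[i j] /= /andP[eij /eqP va]|noa].
      by rewrite coefL // (weightE _ va).
    have := valP a; rewrite inE => /existsP[i /existsP[j eij]].
    by have := noa (i, j); rewrite /= eij.
  apply/symunitP; split.
  - move=> i j; rewrite !mxE orbC (eq_sym i) weight_sym.
    by case: (eqVneq j i) => [->|].
  - by rewrite unitmxE matrix_tree // unitfE.
  - move=> i j; rewrite !in_setD1 => /andP[/negPf ne_ir _] /andP[/negPf ne_jr _] fij.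
    rewrite mxE ne_ir ne_jr /=; have [eq_ij|_] := eqVneq i j.
      by rewrite eq_ij irrf in fij.
    by rewrite weight0 ?oppr0 // eE fij andbF.
  - move=> i j; rewrite in_setD1 in_setT andbT negbK => /eqP->.
    by rewrite mxE eqxx.
case/symunitP=> symM uM pM idM.
have tM : M^T = M by apply/matrixP => i j; rewrite mxE symM.
have Mr j : M r j = (r == j)%:R by rewrite idM // in_setD1 eqxx.
have M0 i j : i != r -> j != r -> i != j -> weight (h M) i j = - M i j.
  move=> ne_ir ne_jr ne_ij; have [fij|nfij] := boolP (f i j).
    by rewrite weight0 ?eE ?fij ?andbF // pM ?oppr0 // in_setD1 ?ne_ir ?ne_jr in_setT.
  by rewrite hE ?eE ?ne_ij // /coef (negPf ne_ir) (negPf ne_jr).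
have Lh : reduced_laplacian r (h M) = M.
  apply/matrixP => i j; rewrite mxE.
  have [->|ne_ir] /= := eqVneq i r; first by rewrite Mr.
  have [->|ne_jr] /= := eqVneq j r; first by rewrite symM Mr eq_sym.
  have [<-|ne_ij] := eqVneq i j; last by rewrite M0 ?opprK.
  (* The edge from [i] to [r] exists because [r] is isolated in [f]; its weight adjusts the diagonal
     entry to the value [M i i]. *)
  rewrite (bigD1 r) //= hE //; last by rewrite eE ne_ir symf nfr.
  rewrite /coef eqxx /rowsum (bigD1 i) //= [X in _ + X](bigD1 i) //= weightii // add0r.
  rewrite -addrA -big_split /= big1 ?addr0 // => k /andP[ne_kr ne_ki].
  by rewrite M0 ?subrr // eq_sym.
split=> //; rewrite inE -(matrix_tree r) // Lh.
by move: uM; rewrite unitmxE unitfE.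
Qed.

Local Close Scope ring_scope.

Theorem corollary12p3 (s r : nat) (V : {set 'I_s}) (f : rel 'I_s)
    (Vr : #|V| = r)
    (fG : simple_graph f)
    (fV : forall x y : 'I_s, f x y -> x \in V /\ y \in V)
    (fF : forest f) :
  polynomial_count (fun K : finFieldType => #|Zo (complete_minus f) K|) /\
  (r < s -> polynomial_count (fun K : finFieldType => #|X (complete_minus f) K|)).
Proof.
have Pf S := polynomial_count_symunit S fG fF; split.
  (* For the full vertex set the identity condition is void, and off the diagonal the non-edges of
     [complete_minus f] are the edges of [f]. *)
  apply: eq_polynomial_count (Pf [set: 'I_s]) => K; apply: eq_card => M.
  rewrite [in RHS]inE; apply/symunitP/and3P => [[symM uM pM _]|[/eqP symM uM pM]].
    split=> //; first by apply/eqP/matrixP => i j; rewrite mxE.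
    apply/forallP => i; apply/forallP => j; apply/implyP => /andP[ne_ij].
    by rewrite /complete_minus /= ne_ij negbK => fij; rewrite pM.
  split=> // [i j|i j _ _ fij|i j]; last by rewrite in_setT.
    by rewrite -[in LHS]symM mxE.
  have ne_ij : i != j by apply: contraTneq fij => ->; rewrite fG.2.
  have /implyP := forallP (forallP pM i) j.
  by rewrite /complete_minus /= ne_ij fij => /(_ isT)/eqP.
move=> lt_rs; have /existsP[v nVv] : [exists v, v \notin V].
  apply: contraLR lt_rs; rewrite negb_exists -leqNgt => /forallP allV.
  rewrite -Vr -[s in (s <= _)%N]card_ord -cardsT subset_leq_card //.
  by apply/subsetP => v _; rewrite -[_ \in _]negbK.
apply: eq_polynomial_count (Pf (setT :\ v)) => K; rewrite (@card_X_symunit s v) // => i.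
by apply/negP => /fV[Vv _]; rewrite Vv in nVv.
Qed.
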